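(* Let $G$ be a bridgeless cubic graph with $m$ edges. If $\tau(G)\le 4$ then $scc(G)=\frac{4}{3}m$.
   Context: The perfect matching index $\tau(G)$ of a bridgeless cubic graph is the smallest integer $k$ such that there exist perfect matchings $M_1,\dots,M_k$ of $G$ whose union is $E(G)$. A cycle cover of $G$ is a collection of cycles covering every edge at least once; its length is the sum of the lengths of its cycles, and $scc(G)$ is the minimum length of a cycle cover of $G$. *)

(* Defs.v *)
From mathcomp Require Import all_boot all_order all_algebra.

Set Implicit Arguments.
Unset Strict Implicit.
Unset Printing Implicit Defensive.

(* Finite multigraphs: parallel edges and loops are allowed.  The pair [ends e]
   stores the two ends of the undirected edge [e] in an arbitrary order. *)
Record graph := Graph {
  vertex : finType;
  edge : finType;
  ends : edge -> vertex * vertex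
}.

Section GraphNotions.

Variable G : graph.

(* A subgraph is given by its edge set [A]; a loop contributes 2 to [deg]. *)
Definition deg (A : {set edge G}) (v : vertex G) : nat :=
  #|[set e in A | (ends e).1 == v]| + #|[set e in A | (ends e).2 == v]|.

Definition adj (A : {set edge G}) : rel (vertex G) :=
  fun u v => [exists e in A, (ends e == (u, v)) || (ends e == (v, u))].

Definition cubic : Prop := forall v : vertex G, deg setT v = 3.

Definition components (A : {set edge G}) : nat := n_comp (adj A) predT.

Definition bridge (e : edge G) : bool :=
  components setT < components [set~ e].

Definition bridgeless : Prop := forall e : edge G, ~~ bridge e.

Definition perfect_matching (M : {set edge G}) : Prop :=
  forall v : vertex G, deg M v = 1.

(* Edge sets of connected 2-regular subgraphs; the vertices of the subgraph
   are those of nonzero degree. *)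
Definition is_cycle (C : {set edge G}) : Prop :=
  [/\ C != set0,
      forall v, deg C v != 0 -> deg C v = 2
    & forall u v, deg C u != 0 -> deg C v != 0 -> connect (adj C) u v].

Definition covered_by_perfect_matchings (k : nat) : Prop :=
  exists M : 'I_k -> {set edge G},
    (forall i, perfect_matching (M i)) /\ \bigcup_i M i = setT.

Definition cycle_cover (F : seq {set edge G}) : Prop :=
  (forall C, C \in F -> is_cycle C) /\
  (forall e : edge G, exists2 C, C \in F & e \in C).

Definition cover_length (F : seq {set edge G}) : nat := \sum_(C <- F) #|C|.

Definition has_cycle_cover_of_length (l : nat) : Prop :=
  exists2 F, cycle_cover F & cover_length F = l.

End GraphNotions.

Definition is_least (P : nat -> Prop) (n : nat) : Prop :=
  P n /\ forall k, P k -> n <= k.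

(* tau(G) = k *)
Definition is_perfect_matching_index (G : graph) (k : nat) : Prop :=
  is_least (covered_by_perfect_matchings G) k.

(* scc(G) = l *)
Definition is_scc (G : graph) (l : nat) : Prop :=
  is_least (has_cycle_cover_of_length G) l.

(* Main.v *)
Require Import Defs.
From mathcomp Require Import all_boot all_order all_algebra.
From mathcomp Require Import zify lra.

(** In a cycle cover the degrees of the cycles at a vertex add up to an even
    number that is at least 3, hence at least 4, so that the length is at least
    [2 * #|V| = 4/3 m].  Conversely, let four perfect matchings cover the edges.
    The four edge-matching incidences at a vertex are spread over three edges,
    so that exactly one of these edges lies in two matchings and the others lie
    in one: the doubly covered edges form a perfect matching [D].  The
    symmetric differences of [D] with the four matchings are disjoint unions of
    cycles, and each edge lies in as many of them as of the matchings (two of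
    four if it is in [D], one otherwise), so that they form a cover in which
    every vertex has total degree 4. *)

Set Implicit Arguments.
Unset Strict Implicit.
Unset Printing Implicit Defensive.

Definition regular (G : graph) (r : nat) : Prop :=
  forall v : vertex G, deg setT v = r.

Definition covers (G : graph) (F : seq {set edge G}) : Prop :=
  forall e, exists2 A, A \in F & e \in A.

Definition multiplicity (G : graph) (F : seq {set edge G}) (e : edge G) : nat :=
  count (fun A : {set edge G} => e \in A) F.

Definition symdiff (T : finType) (A B : {set T}) : {set T} :=
  [set x | (x \in A) (+) (x \in B)].

Section Degrees.

Variable G : graph.
Implicit Types (A B C : {set edge G}) (F : seq {set edge G}).
Implicit Types (v : vertex G) (e : edge G).

Definition incidence e v : nat := ((ends e).1 == v) + ((ends e).2 == v).

Lemma deg_sum_incidence A v : deg A v = \sum_e (e \in A) * incidence e v.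
Proof.
rewrite /deg -!sum1_card ![\sum_(e in _) 1]big_mkcond -big_split /=.
apply: eq_bigr => e _; rewrite !inE /incidence.
by case: (e \in A); case: eqP; case: eqP.
Qed.

Lemma deg_setT v : deg setT v = \sum_e incidence e v.
Proof.
by rewrite deg_sum_incidence; apply: eq_bigr => e _; rewrite inE mul1n.
Qed.

Lemma deg_symdiff A B v :
  deg (symdiff A B) v + 2 * deg (A :&: B) v = deg A v + deg B v.
Proof.
rewrite !deg_sum_incidence big_distrr -!big_split /=.
apply: eq_bigr => e _; rewrite !inE.
by case: (e \in A); case: (e \in B) => /=; lia.
Qed.

Lemma sum_incidence e : \sum_v incidence e v = 2.
Proof.
have sum_eq u : \sum_v (u == v : nat) = 1.
  by rewrite (bigD1 u) //= eqxx big1 // => v; rewrite eq_sym => /negPf ->.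
by rewrite big_split /= !sum_eq.
Qed.

Lemma handshake A : \sum_v deg A v = 2 * #|A|.
Proof.
under eq_bigr do rewrite deg_sum_incidence.
rewrite exchange_big -sum1_card big_distrr [RHS]big_mkcond /=.
apply: eq_bigr => e _; rewrite -big_distrr /= sum_incidence.
by case: (e \in A).
Qed.

Lemma handshake_cover_length F :
  \sum_v \sum_(A <- F) deg A v = 2 * cover_length F.
Proof.
rewrite exchange_big /cover_length big_distrr.
by under eq_bigr do rewrite handshake.
Qed.

Lemma regular_handshake r : regular G r -> r * #|vertex G| = 2 * #|edge G|.
Proof.
move=> reg; rewrite -(cardsT (edge G)) -handshake; under eq_bigr do rewrite reg.
by rewrite sum_nat_const mulnC.
Qed.

Lemma multiplicity_gt0P F e :
  reflect (exists2 A, A \in F & e \in A) (0 < multiplicity F e).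
Proof. by rewrite -has_count; apply: hasP. Qed.

Lemma sum_deg_multiplicity F v :
  \sum_(A <- F) deg A v = \sum_e multiplicity F e * incidence e v.
Proof.
under eq_bigr do rewrite deg_sum_incidence.
rewrite exchange_big /=; apply: eq_bigr => e _.
by rewrite -big_distrl /multiplicity -sumn_count sumnE big_map.
Qed.

Lemma sum_deg_covers F v : covers F ->
  \sum_(A <- F) deg A v
  = deg setT v + \sum_e (multiplicity F e).-1 * incidence e v.
Proof.
move=> covF; rewrite sum_deg_multiplicity deg_setT -big_split /=.
apply: eq_bigr => e _; rewrite -mulSn prednK //.
exact/multiplicity_gt0P.
Qed.

Lemma deg_cycle_even C v : is_cycle C -> ~~ odd (deg C v).
Proof. by case=> _ deg2 _; have [->|/deg2 ->] := eqVneq (deg C v) 0. Qed.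

Lemma cycle_cover_length_lower_bound F : cycle_cover F ->
  2 * #|edge G| + #|[set v | odd (deg [set: edge G] v)]| <= 2 * cover_length F.
Proof.
case=> cycF covF; rewrite -(cardsT (edge G)) -handshake -handshake_cover_length.
rewrite -sum1_card [\sum_(v in _) 1]big_mkcond -big_split /=.
apply: leq_sum => v _.
have even_sum : ~~ odd (\sum_(C <- F) deg C v).
  rewrite (big_morph odd oddD (erefl _)) big1_seq // => C /andP[_ CF].
  by apply/negbTE/deg_cycle_even/cycF.
by rewrite inE; have := sum_deg_covers v covF; case: ifP; lia.
Qed.

Lemma odd_regular_cycle_cover_length r F :
  odd r -> regular G r -> cycle_cover F ->
  r.+1 * #|vertex G| <= 2 * cover_length F.
Proof.
move=> odd_r reg cycF.
have odd_deg : [set v | odd (deg [set: edge G] v)] = setT.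
  by apply/setP => v; rewrite !inE reg.
have := cycle_cover_length_lower_bound cycF.
by rewrite odd_deg cardsT -(regular_handshake reg) (mulSnr r).
Qed.

End Degrees.

Section EdgeComponents.

Variable G : graph.
Implicit Types (A C : {set edge G}) (u v : vertex G) (e : edge G).

Definition component_edges A u : {set edge G} :=
  [set e in A | connect (adj A) u (ends e).1].

Definition edge_components A : {set {set edge G}} :=
  [set component_edges A (ends e).1 | e in A].

Lemma connect_adj_sym A : connect_sym (adj A).
Proof.
by apply: sym_connect_sym => u v; apply: eq_existsb => e; rewrite orbC.
Qed.

Lemma connect_incidence A u v e : e \in A -> 0 < incidence e v ->
  connect (adj A) u (ends e).1 = connect (adj A) u v.
Proof.
move=> eA; have adj_e : adj A (ends e).1 (ends e).2.
  by apply/existsP; exists e; rewrite eA -surjective_pairing eqxx.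
rewrite /incidence; case: eqP => [-> //|_]; case: eqP => [<- _|//].
rewrite ![connect _ u _]connect_adj_sym.
exact/same_connect/connect1/adj_e/connect_adj_sym.
Qed.

Lemma deg_component_edges A u v :
  deg (component_edges A u) v = connect (adj A) u v * deg A v.
Proof.
rewrite !deg_sum_incidence big_distrr /=; apply: eq_bigr => e _; rewrite inE.
have [->|] := posnP (incidence e v); first by rewrite !muln0.
case: (boolP (e \in A)) => [eA pos_ev|_ _]; last by rewrite muln0.
by rewrite (connect_incidence _ eA pos_ev) mul1n.
Qed.

Lemma connect_component_edges A u v :
  connect (adj A) u v -> connect (adj (component_edges A u)) u v.
Proof.
set C := component_edges A u => Auv.
have connectCA : subrel (connect (adj C)) (connect (adj A)).
  apply: connect_sub => x y /existsP[e /andP[]]; rewrite inE => /andP[eA _] xy.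
  by apply/connect1/existsP; exists e; rewrite eA.
have closedC : closed (adj A) (connect (adj C) u).
  apply: (intro_closed (connect_adj_sym A)) => x y /existsP[e /andP[eA xy]] Cux.
  have pos_ex : 0 < incidence e x.
    by rewrite /incidence; case/orP: xy => /eqP ->; rewrite /= eqxx ?addn1.
  apply: connect_trans (Cux) (connect1 _); apply/existsP; exists e; rewrite xy.
  by rewrite inE eA (connect_incidence _ eA pos_ex) connectCA.
rewrite -[connect _ _ _]/(v \in connect (adj C) u).
by rewrite -(closed_connect closedC Auv); apply: connect0.
Qed.

Lemma edge_components_partition A : partition (edge_components A) A.
Proof.
apply: equivalence_partitionP => e f g _ _ _.
by split=> [|/(same_connect (connect_adj_sym A)) ->].
Qed.

Definition two_regular A : Prop := forall v, deg A v != 0 -> deg A v = 2.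

Lemma edge_components_cycle A C :
  two_regular A -> C \in edge_components A -> is_cycle C.
Proof.
move=> regA /imsetP[e eA ->]; set u := (ends e).1; split.
- by apply/set0Pn; exists e; rewrite inE eA connect0.
- move=> v; rewrite deg_component_edges.
  by case: connect; rewrite ?mul1n //; apply: regA.
- have from_u w : deg (component_edges A u) w != 0 ->
      connect (adj (component_edges A u)) u w.
    rewrite deg_component_edges muln_eq0 negb_or eqb0 negbK => /andP[Auw _].
    exact: connect_component_edges.
  move=> v w /from_u Cuv /from_u; apply: connect_trans.
  by rewrite connect_adj_sym.
Qed.

Lemma cycle_cover_of_two_regular (F : seq {set edge G}) :
  {in F, forall A, two_regular A} -> covers F ->
  has_cycle_cover_of_length G (cover_length F).
Proof.
move=> regF covF; exists (flatten [seq enum (edge_components A) | A <- F]).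
  split=> [C /flatten_mapP[A AF]|e].
    by rewrite mem_enum; apply/edge_components_cycle/regF.
  have [A AF eA] := covF e.
  have /bigcupP[C CA eC] : e \in cover (edge_components A).
    by rewrite (cover_partition (edge_components_partition A)).
  by exists C => //; apply/flatten_mapP; exists A; rewrite ?mem_enum.
rewrite /cover_length big_flatten big_map; apply: eq_bigr => A _.
by rewrite big_enum (card_partition (edge_components_partition A)).
Qed.

End EdgeComponents.

Section PerfectMatchingCovers.

Variable G : graph.
Implicit Types (M N : {set edge G}) (s : seq {set edge G}) (e : edge G).

Definition perfect_matching_cover s : Prop :=
  {in s, forall M, perfect_matching M} /\ covers s.

Lemma perfect_matching_cover_of_size k n :
  (forall v, 0 < deg [set: edge G] v) -> k <= n ->
  covered_by_perfect_matchings G k ->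
  exists2 s, perfect_matching_cover s & size s = n.
Proof.
case: k => [|k] deg_gt0 lekn [M [pmM covM]].
  have no_edge e : False by have := in_setT e; rewrite -covM big_ord0 inE.
  exists (nseq n set0); last exact: size_nseq.
  split=> [N _ v|e]; last by case: (no_edge e).
  by have := deg_gt0 v; rewrite deg_setT big1 // => e; case: (no_edge e).
exists (mkseq (fun i => M (inord i)) n); last exact: size_mkseq.
split=> [N /mapP[i _ ->]|e]; first exact: pmM.
have /bigcupP[i _ eMi] : e \in \bigcup_i M i by rewrite covM inE.
exists (M i) => //; apply/mapP; exists (val i); last by rewrite inord_val.
by rewrite mem_iota (leq_trans (ltn_ord i)).
Qed.

Lemma symdiff_perfect_matchings_two_regular M N :
  perfect_matching M -> perfect_matching N -> two_regular (symdiff M N).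
Proof.
by move=> pmM pmN v; have := deg_symdiff M N v; rewrite pmM pmN; lia.
Qed.

Lemma multiplicity_map_symdiff s M e :
  multiplicity [seq symdiff N M | N <- s] e
  = if e \in M then size s - multiplicity s e else multiplicity s e.
Proof.
rewrite /multiplicity count_map.
rewrite -(count_predC (fun N : {set edge G} => e \in N) s) addKn.
by case: ifP => eM; apply: eq_count => N; rewrite /= inE eM ?addbT ?addbF.
Qed.

Definition multiply_covered s : {set edge G} := [set e | 1 < multiplicity s e].

Section OneMoreThanDegree.

Variables (r : nat) (s : seq {set edge G}).
Hypotheses (regG : regular G r) (pmcs : perfect_matching_cover s).
Hypothesis size_s : size s = r.+1.

Lemma sum_excess_multiplicity v :
  \sum_e (multiplicity s e).-1 * incidence e v = 1.
Proof.
have [pms covs] := pmcs; apply/(@addnI r).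
rewrite -[in LHS](regG v) -sum_deg_covers // addn1 -size_s -sum1_size.
by apply: eq_big_seq => M /pms ->.
Qed.

Lemma multiplicity_multiply_covered e :
  multiplicity s e = (e \in multiply_covered s).+1.
Proof.
have mult_gt0 : 0 < multiplicity s e by apply/multiplicity_gt0P/pmcs.2.
have := sum_excess_multiplicity (ends e).1.
rewrite (bigD1 e) //= inE /incidence eqxx; nia.
Qed.

Lemma multiply_covered_perfect_matching : perfect_matching (multiply_covered s).
Proof.
move=> v; rewrite -(sum_excess_multiplicity v) deg_sum_incidence.
by apply: eq_bigr => e _; rewrite [in RHS]multiplicity_multiply_covered.
Qed.

Lemma regular_cycle_cover :
  1 < r -> has_cycle_cover_of_length G (r.-1 * #|vertex G|).
Proof.
move=> r_gt1; set D := multiply_covered s.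
set F := [seq symdiff M D | M <- s].
have multF e : multiplicity F e = ((e \in D) * (r - 2)).+1.
  rewrite multiplicity_map_symdiff size_s multiplicity_multiply_covered.
  by case: (e \in D); lia.
have covF : covers F by move=> e; apply/multiplicity_gt0P; rewrite multF.
have sum_degF v : \sum_(A <- F) deg A v = 2 * r.-1.
  have <- : r + (r - 2) * deg D v = 2 * r.-1.
    by rewrite multiply_covered_perfect_matching; lia.
  rewrite sum_deg_covers // regG deg_sum_incidence big_distrr; congr (_ + _).
  by apply: eq_bigr => e _; rewrite multF mulnAC mulnC.
have <- : cover_length F = r.-1 * #|vertex G|.
  apply/eqP; rewrite -(eqn_pmul2l (ltn0Sn 1)) -handshake_cover_length.
  by under eq_bigr do rewrite sum_degF; rewrite sum_nat_const mulnC -mulnA.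
apply: cycle_cover_of_two_regular covF => A /mapP[M Ms ->].
apply: symdiff_perfect_matchings_two_regular multiply_covered_perfect_matching.
exact: pmcs.1.
Qed.

End OneMoreThanDegree.

End PerfectMatchingCovers.

Theorem theorem5p3 (G : graph) (m k : nat)
    (hcubic : cubic G) (hbridgeless : bridgeless G) (hm : #|edge G| = m)
    (htau : is_perfect_matching_index G k) (hk : k <= 4) :
  exists l : nat, is_scc G l /\ (l%:R = 4%:R / 3%:R * m%:R :> rat)%R.
Proof.
have deg_gt0 v : 0 < deg [set: edge G] v by rewrite hcubic.
have [s pmcs size_s] := perfect_matching_cover_of_size deg_gt0 hk htau.1.
exists (2 * #|vertex G|); split.
  split=> [|l [F cycF <-]].
    exact: regular_cycle_cover hcubic pmcs size_s isT.
  have := odd_regular_cycle_cover_length (isT : odd 3) hcubic cycF; lia.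
have := congr1 (fun n => n%:R%R : rat) (regular_handshake hcubic).
rewrite hm !GRing.natrM => handshakeG; lra.
Qed.
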